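(* Let $n=2m+1$ with $m\ge1$, let $a,b,c,d\in\mathbb{C}$, and suppose $T_n$ (degree $n$) and $U_{n-2}$ (degree at most $n-2$) satisfy $T_n^2-HU_{n-2}^2=1$ with $$T_n(z)=1-\frac{2(z-d)\prod_{j=1}^{m}(z-x_j)^2}{(a-d)\prod_{j=1}^m(a-x_j)^2}=-1+\frac{2(z-a)(z-b)(z-c)\prod_{j=1}^{m-1}(z-y_j)^2}{(d-a)(d-b)(d-c)\prod_{j=1}^{m-1}(d-y_j)^2}$$ for some $x_1,\dots,x_m,y_1,\dots,y_{m-1}\in\mathbb{C}$. Put $s_k:=\tfrac12\bigl(a^k-b^k-c^k+d^k\bigr)$, $k=1,\dots,2m$, and form $F_k,\mathbf F,\mathbf F_i$ with $\nu=m$, $\mu=m$. Then $\det\mathbf F\ne0$ and $x_1,\dots,x_m$ (with multiplicity) are exactly the zeros of the polynomial $$x^{m}\det\mathbf F+x^{m-1}\det\mathbf F_1+\dots+x\det\mathbf F_{m-1}+\det\mathbf F_{m}.$$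
   Context: $H(z)=(z-a)(z-b)(z-c)(z-d)$. Given complex numbers $s_1,s_2,\dots$, set $F_0:=1$, $F_k:=0$ for $k<0$, and for $k\ge1$, $F_k:=\frac{(-1)^k}{k!}\det M_k$ where $M_k$ is the $k\times k$ matrix with entry $s_{i-j+1}$ for $j\le i$, entry $i$ at position $(i,i+1)$, and $0$ elsewhere. For integers $\nu\ge0,\mu\ge1$, $\mathbf F$ is the $\mu\times\mu$ matrix with $(i,j)$ entry $F_{\nu+i-j}$, and $\mathbf F_i$ ($1\le i\le\mu$) is $\mathbf F$ with its $i$-th column replaced by $(-F_{\nu+1},\dots,-F_{\nu+\mu})^T$. *)

(* Defs.v *)
From HB Require Import structures.
From mathcomp Require Import all_boot all_order all_algebra.
Set Implicit Arguments. Unset Strict Implicit. Unset Printing Implicit Defensive.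
Import Order.TTheory GRing.Theory Num.Theory.
Local Open Scope ring_scope.

Definition Hpoly (R : nzRingType) (a b c d : R) : {poly R} :=
  ('X - a%:P) * ('X - b%:P) * ('X - c%:P) * ('X - d%:P).

(* M_k : k x k matrix; with 1-based indices (i,j): s_{i-j+1} if j <= i,
   i if j = i+1, 0 otherwise.  Here i,j are 0-based (i' = i-1, j' = j-1). *)
Definition Mk (R : nzRingType) (s : nat -> R) (k : nat) : 'M[R]_k :=
  \matrix_(i < k, j < k)
     if (j <= i)%N then s (i - j).+1
     else if j == i.+1 :> nat then (i.+1)%:R else 0.

Definition Fn (R : fieldType) (s : nat -> R) (k : nat) : R :=
  if k == 0%N then 1 else (-1) ^+ k / (k`!)%:R * \det (Mk s k).

Definition Fz (R : fieldType) (s : nat -> R) (k : int) : R :=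
  match k with Posz n => Fn s n | Negz _ => 0 end.

Definition Fmat (R : fieldType) (s : nat -> R) (nu mu : nat) : 'M[R]_mu :=
  \matrix_(i < mu, j < mu) Fz s (nu%:Z + i%:Z - j%:Z).

(* bold F_i (0-based column index i, i.e. paper's F_{i+1}): column i replaced by
   (-F_{nu+1}, ..., -F_{nu+mu})^T *)
Definition Fmat_col (R : fieldType) (s : nat -> R) (nu mu : nat) (c : 'I_mu)
  : 'M[R]_mu :=
  \matrix_(i < mu, j < mu)
     if j == c then - Fz s (nu + i + 1)%N%:Z else Fmat s nu mu i j.

(* Main.v *)
(* Equating the two expressions of T and substituting 1/t for z gives
     (1 - d t) p(t)^2 - (1 - a t)(1 - b t)(1 - c t) q(t)^2 = K t^(2m+1)
   with K <> 0, p(t) = prod (1 - x_j t) and q(t) = prod (1 - y_j t).  The F_k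
   are the coefficients of f = exp(- sum s_k t^k / k), that is, of the square
   root of (1 - a t)(1 - d t) / ((1 - b t)(1 - c t)) with value 1 at 0.  Hence
   (f p)^2 and ((1 - a t) q)^2 agree modulo t^(2m+1), and so do f p and
   (1 - a t) q: p is a Pade denominator of f.  The vanishing of the coefficients
   of f p in degrees m+1, ..., 2m is a linear system with matrix F for the
   coefficients of p, which Cramer's rule solves. *)
Require Import Defs.
From HB Require Import structures.
From mathcomp Require Import all_boot all_order all_algebra.
From mathcomp Require Import ring zify.
Import Order.TTheory GRing.Theory Num.Theory.
Local Open Scope ring_scope.

(** * Divisibility by powers of ['X] and the recursion for [Fn] *)

Lemma dvdXnP (F : fieldType) (n : nat) (p : {poly F}) :
  reflect (forall i, (i < n)%N -> p`_i = 0) ('X^n %| p).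
Proof.
apply: (iffP idP) => [/dvdpP [q ->] i lin|H].
  by rewrite coefMXn lin.
suff -> : p = drop_poly n p * 'X^n by rewrite dvdp_mulIr.
rewrite -[LHS](poly_take_drop n) (_ : take_poly n p = 0) ?add0r //.
by apply/polyP => i; rewrite coef_take_poly coef0; case: ltnP => // /H.
Qed.

(** Otherwise [p - q] would have more roots, among 1, 2, 3, ..., than its degree allows. This
    licenses the substitution of [t^-1]. *)
Lemma eq_poly_nonzero (F : numFieldType) (p q : {poly F}) :
  (forall t, t != 0 -> p.[t] = q.[t]) -> p = q.
Proof.
move=> H; apply/eqP; rewrite -subr_eq0; apply/negPn/negP => nz.
have := @max_poly_roots _ (p - q) [seq i.+1%:R | i <- iota 0 (size (p - q))] nz.
rewrite size_map size_iota ltnn => H'; apply: notF; apply: H'.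
  apply/allP => _ /mapP [i _ ->]; rewrite /root hornerD hornerN H ?subrr //.
  by rewrite pnatr_eq0.
by rewrite map_inj_uniq ?iota_uniq // => i j /eqP; rewrite eqr_nat => /eqP [].
Qed.

(* By the recursion at smaller indices, M_{n+1} maps the column (F_0, ..., F_n)
   to a multiple of the last basis vector, so one row of the adjugate yields
   the determinant. *)
Lemma Fn_rec (F : numFieldType) (s : nat -> F) (n : nat) :
  n.+1%:R * Fn s n.+1 = - \sum_(j < n.+1) s (n - j).+1 * Fn s j.
Proof.
have [k] := ubnP n; elim: k n => // k IH n; rewrite ltnS => lenk.
set r := \sum_(j < _) _.
pose v : 'cV[F]_n.+1 := \col_j Fn s j.
have Mv : Mk s n.+1 *m v = r *: delta_mx ord_max 0.
  apply/matrixP => i j; rewrite [j]ord1 !mxE eqxx andbT.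
  have [->|nei] := eqVneq i ord_max.
    rewrite mulr1; apply: eq_bigr => l _.
    by rewrite !mxE /= -ltnS ltn_ord.
  have lin : (i < n)%N.
    by rewrite ltn_neqAle -ltnS ltn_ord andbT; apply: contraNneq nei => e;
       apply/eqP/val_inj.
  have := IH i (leq_trans lin lenk) => e.
  (* In a row above the last, the superdiagonal entry contributes [i.+1%:R * Fn s i.+1], which
     cancels the terms with [l <= i] by the recursion. *)
  rewrite mulr0 -[RHS](subrr (i.+1%:R * Fn s i.+1)) {2}e opprK addrC.
  rewrite (bigID (fun l : 'I_n.+1 => (l <= i)%N)) /=; congr (_ + _).
    rewrite (big_ord_widen n.+1 (fun l => s (i - l).+1 * Fn s l)) ?ltnS 1?ltnW //.
    by apply: eq_big => [l|l li]; rewrite ?ltnS // !mxE li.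
  rewrite (bigD1 (Ordinal (lin : (i.+1 < n.+1)%N))) /= ?ltnn // !mxE /= ltnn eqxx.
  rewrite big1 ?addr0 // => l /andP [nli nel]; rewrite !mxE (negPf nli).
  by rewrite ifN ?mul0r //; apply: contraNneq nel => e'; apply/eqP/val_inj.
have : (\det (Mk s n.+1))%:M *m v
       = \adj (Mk s n.+1) *m (r *: delta_mx ord_max 0).
  by rewrite -Mv mulmxA mul_adj_mx.
move/matrixP/(_ ord0 ord0); rewrite mul_scalar_mx -scalemxAr -colE !mxE /=.
(* Deleting the last row and the first column leaves a lower triangular matrix with diagonal 1, ...,
   n, so the minor is n!. *)
rewrite {1}/Fn eqxx mulr1 /cofactor [\det (row' _ _)]det_trig; last first.
  apply/is_trig_mxP => i j lij; rewrite !mxE lift_max lift0.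
  by rewrite leqNgt ltnW //= eqSS gtn_eqF.
rewrite (eq_bigr (fun i : 'I_n => i.+1%:R)); last first.
  by move=> i _; rewrite !mxE lift_max lift0 ltnn eqxx.
rewrite -(big_mkord xpredT (fun i => i.+1%:R)) -natr_prod.
rewrite -(big_add1 _ _ 0 n.+1 xpredT id) -fact_prod addn0.
rewrite /Fn /= => ->; rewrite factS exprS natrM.
have n0 : n`!%:R != 0 :> F by rewrite pnatr_eq0 -lt0n fact_gt0.
have n1 : n.+1%:R != 0 :> F by rewrite pnatr_eq0.
have : ((-1) ^+ n) ^+ 2 = 1 :> F by rewrite sqrr_sign.
move: ((-1) ^+ n : F) => e e2.
by transitivity (- (e ^+ 2 * r)); [field; rewrite n0 -mulrS | rewrite e2 mul1r].
Qed.

Lemma coefM_wide (R : nzRingType) (f v : {poly R}) (n k : nat) :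
  (size v <= n <= k.+1)%N -> (f * v)`_k = \sum_(j < n) f`_(k - j) * v`_j.
Proof.
case/andP => sv nk; rewrite coefMr.
rewrite [RHS](big_ord_widen k.+1 (fun j => f`_(k - j) * v`_j)) // [RHS]big_mkcond.
apply: eq_bigr => j _; case: ltnP => // nj.
by rewrite [v`_j]nth_default ?mulr0 // (leq_trans sv).
Qed.

Lemma coprimepXn (F : fieldType) (n : nat) (p : {poly F}) :
  p.[0] != 0 -> coprimep 'X^n p.
Proof.
by move=> p0; rewrite coprimep_expl // coprimep_sym coprimepX /root p0.
Qed.

(** The Wronskian is A^2 times the derivative of D / A, a quotient that vanishes at 0; integrating
    it gains one power of ['X]. *)
Lemma dvdXn_wronskian (F : numFieldType) (N : nat) (A D : {poly F}) :
  A.[0] != 0 -> D.[0] = 0 -> 'X^N %| D^`() * A - D * A^`() ->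
  'X^(N.+1) %| D.
Proof.
move=> A0 D0 H.
have: forall k, (k <= N)%N -> 'X^(k.+1) %| D; last by apply.
elim=> [|k IH] kN.
  by apply/dvdXnP => -[|//] _; rewrite -horner_coef0.
have DX := IH (ltnW kN).
have : 'X^(k.+1) %| D^`().
  rewrite -(@Gauss_dvdpl _ _ A) ?coprimepXn //.
  rewrite -[D^`() * A](subrK (D * A^`())) dvdp_addr ?dvdp_mulr //.
  by apply: dvdp_trans H; rewrite dvdp_exp2l.
move=> /dvdXnP H'; apply/dvdXnP => -[|i] ik.
  by rewrite -horner_coef0.
by have /eqP := H' i ik; rewrite coef_deriv mulrn_eq0 /= => /eqP.
Qed.

(** * The generating polynomial of the [Fn s k] as a truncated square root *)

(** The sum truncates e / (1 - e X), which is minus the logarithmic derivative of 1 - e X. *)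
Lemma geom_polyE (F : fieldType) (N : nat) (e : F) :
  (1 - e%:P * 'X) * (\poly_(i < N) e ^+ i.+1)
  = e%:P - e%:P * (e%:P * 'X) ^+ N.
Proof.
have -> : \poly_(i < N) e ^+ i.+1 = e%:P * \sum_(i < N) (e%:P * 'X) ^+ i.
  rewrite poly_def mulr_sumr; apply: eq_bigr => i _.
  by rewrite exprMn -mul_polyC exprS polyCM !polyC_exp mulrA.
have := subrX1 (e%:P * 'X) N; set x := _ * 'X; set S := \sum_(_ < _) _ => H.
have -> : e%:P - e%:P * x ^+ N = - e%:P * (x ^+ N - 1) by ring.
by rewrite H; ring.
Qed.

Definition half_sum {F : fieldType} (a b c d : F) (k : nat) : F :=
  (a ^+ k - b ^+ k - c ^+ k + d ^+ k) / 2.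

Lemma half_sum_poly (F : numFieldType) (a b c d : F) (N : nat) :
  (\poly_(i < N) half_sum a b c d i.+1) *+ 2 =
  (\poly_(i < N) a ^+ i.+1) - (\poly_(i < N) b ^+ i.+1)
  - (\poly_(i < N) c ^+ i.+1) + (\poly_(i < N) d ^+ i.+1).
Proof.
apply/polyP => i; rewrite !(coefD, coefB, coefN, coefMn, coef_poly).
case: ifP => _; last by rewrite !subr0 addr0 mul0rn.
by rewrite /half_sum; field.
Qed.

(** This is [Fn_rec] read one coefficient at a time: minus the series of the s_k is the logarithmic
    derivative of f. *)
Lemma Fn_deriv (F : numFieldType) (s : nat -> F) (N : nat) :
  'X^N %| (\poly_(i < N.+1) Fn s i)^`()
          + (\poly_(i < N) s i.+1) * (\poly_(i < N.+1) Fn s i).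
Proof.
apply/dvdXnP => i iN; rewrite coefD coef_deriv coef_poly ltnS iN coefMr.
rewrite -[_ *+ _]mulr_natl Fn_rec.
rewrite -[RHS](subrr (\sum_(j < i.+1) s (i - j).+1 * Fn s j)).
rewrite addrC; congr (_ - _); apply: eq_bigr => j _.
have ji : (j <= i)%N by rewrite -ltnS.
rewrite !coef_poly (leq_ltn_trans (leq_subr _ _) iN).
by rewrite ltnS (leq_trans ji (ltnW iN)).
Qed.

(* The two terms of the difference have the same logarithmic derivative modulo 'X^N. *)
Lemma Fn_sq (F : numFieldType) (a b c d : F) (N : nat) :
  'X^(N.+1) %| (1 - b%:P * 'X) * (1 - c%:P * 'X)
                 * (\poly_(i < N.+1) Fn (half_sum a b c d) i) ^+ 2
               - (1 - a%:P * 'X) * (1 - d%:P * 'X).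
Proof.
have f0 : (\poly_(i < N.+1) Fn (half_sum a b c d) i).[0] = 1.
  by rewrite horner_coef0 coef_poly.
have := Fn_deriv _ (half_sum a b c d) N; have := half_sum_poly _ a b c d N.
move: (\poly_(i < N.+1) _) f0 => f f0; move: (\poly_(i < N) _) => S.
have ha := geom_polyE _ N a; have hb := geom_polyE _ N b.
have hc := geom_polyE _ N c; have hd := geom_polyE _ N d.
move: (\poly_(i < N) a ^+ _) ha => ga ha.
move: (\poly_(i < N) b ^+ _) hb => gb hb.
move: (\poly_(i < N) c ^+ _) hc => gc hc.
move: (\poly_(i < N) d ^+ _) hd => gd hd.
move=> hS hf.
have h0 (e : F) : (1 - e%:P * 'X).[0] = 1 by rewrite !hornerE ?mulr0 ?subr0.
have hX (e : F) : 'X^N %| (e%:P * 'X) ^+ N by rewrite exprMn dvdp_mulIr.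
have dl (e : F) : (1 - e%:P * 'X)^`() = - e%:P.
  by rewrite !derivE ?(mul0r, add0r, mulr1, sub0r).
apply: (@dvdXn_wronskian _ _ ((1 - a%:P * 'X) * (1 - d%:P * 'X))).
- by rewrite hornerM !h0 mulr1 oner_neq0.
- by rewrite hornerD hornerN !hornerM !h0 f0 !mulr1 subrr.
move: hf; rewrite expr2 !(derivM, derivB, dl); set f' := f^`() => hf.
move: (1 - a%:P * 'X) (1 - b%:P * 'X) (1 - c%:P * 'X) (1 - d%:P * 'X)
  ha hb hc hd => la lb lc ld ha hb hc hd {h0 dl}.
have wa := hX a; have wb := hX b; have wc := hX c; have wd := hX d.
move: ((_ * _) ^+ _) wa ha => wa Ha ha.
move: ((b%:P * _) ^+ _) wb hb => wb Hb hb.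
move: ((c%:P * _) ^+ _) wc hc => wc Hc hc.
move: ((d%:P * _) ^+ _) wd hd => wd Hd hd.
set g := (X in _ %| X).
(* By [Fn_deriv], ['X^N] divides the first summand. In the second, each geometric sum meets its own
   linear factor, and all cancels except multiples of the [N]-th powers. *)
have -> : g = (f' + S * f) * (lb * lc * la * ld * f *+ 2)
  + f ^+ 2 * (- (b%:P * lc + c%:P * lb) * la * ld
     + (a%:P * ld + d%:P * la) * lb * lc
     - lb * lc * la * ld * (S *+ 2)) by rewrite /g; ring.
rewrite hS.
have -> : lb * lc * la * ld * (ga - gb - gc + gd) =
  lb * lc * ld * (la * ga) - la * lc * ld * (lb * gb)
  - la * lb * ld * (lc * gc) + la * lb * lc * (ld * gd) by ring.
rewrite ha hb hc hd dvdp_addr; last exact: dvdp_mulr.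
rewrite dvdp_mull //.
set h := (X in _ %| X).
have -> : h = (lb * lc * ld * a%:P) * wa - (la * lc * ld * b%:P) * wb
  - (la * lb * ld * c%:P) * wc + (la * lb * lc * d%:P) * wd by rewrite /h; ring.
by rewrite !(dvdp_add, dvdp_sub, dvdpNr, dvdp_mull).
Qed.

(** * Reversed polynomials *)

Lemma prod_revE (F : fieldType) (n : nat) (x : 'I_n -> F) (t : F) : t != 0 ->
  (\prod_(j < n) (1 - (x j)%:P * 'X)).[t]
  = t ^+ n * (\prod_(j < n) ('X - (x j)%:P)).[t^-1].
Proof.
move=> t0; rewrite !horner_prod -[n in t ^+ n]card_ord -prodr_const -big_split.
by apply: eq_bigr => j _; rewrite !hornerE /= mulrBr divff // mulrC.
Qed.

Lemma size_mul_le (R : nzRingType) (p q : {poly R}) (i j : nat) :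
  (size p <= i.+1)%N -> (size q <= j.+1)%N -> (size (p * q)%R <= (i + j).+1)%N.
Proof.
move=> sp sq; apply: (leq_trans (size_polyMleq _ _)).
by rewrite -subn1 leq_subLR (leq_trans (leq_add sp sq)) // addnS addSn.
Qed.

Lemma size_rev_factor (R : nzRingType) (e : R) : (size (1 - e%:P * 'X)%R <= 2)%N.
Proof.
rewrite addrC -mulNr -polyCN size_MXaddC; case: ifP => // _.
by rewrite ltnS size_polyC_leq1.
Qed.

Lemma size_prod_rev (F : fieldType) (n : nat) (x : 'I_n -> F) :
  (size (\prod_(j < n) (1 - (x j)%:P * 'X))%R <= n.+1)%N.
Proof.
elim: n x => [|n IH] x; first by rewrite big_ord0 size_poly1.
rewrite big_ord_recl; apply: (@size_mul_le _ _ _ 1 n); last exact: IH.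
exact: size_rev_factor.
Qed.

Lemma prod_rev0 (F : fieldType) (n : nat) (x : 'I_n -> F) :
  (\prod_(j < n) (1 - (x j)%:P * 'X)).[0] = 1.
Proof.
by rewrite horner_prod big1 // => j _; rewrite !hornerE ?mulr0 ?subr0.
Qed.

Lemma prod_XsubC_rev (F : numFieldType) (n : nat) (x : 'I_n -> F) :
  \prod_(j < n) ('X - (x j)%:P)
  = \sum_(i < n.+1) (\prod_(j < n) (1 - (x j)%:P * 'X))`_i *: 'X^(n - i).
Proof.
apply: eq_poly_nonzero => t t0.
have tV : t^-1 != 0 by rewrite invr_eq0.
have := prod_revE _ n x _ tV; rewrite invrK exprVn.
move=> e; rewrite -[LHS](mulVKf (expf_neq0 n t0)) -e.
rewrite (horner_coef_wide _ (size_prod_rev _ n x)) horner_sum mulr_sumr.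
apply: eq_bigr => i _; have le_in : (i <= n)%N by rewrite -ltnS.
rewrite !hornerE -{1}(subnK le_in) exprD exprVn /=.
by rewrite mulrAC mulfK ?expf_neq0 // mulrC.
Qed.

Lemma pell_rev (F : numFieldType) (m : nat) (a b c d K L : F)
  (x : 'I_m.+1 -> F) (y : 'I_m -> F) :
  let P := \prod_(j < m.+1) ('X - (x j)%:P) in
  let Q := \prod_(j < m) ('X - (y j)%:P) in
  let p := \prod_(j < m.+1) (1 - (x j)%:P * 'X) in
  let q := \prod_(j < m) (1 - (y j)%:P * 'X) in
  K * L != 0 ->
  K^-1 *: (('X - d%:P) * P ^+ 2)
  + L^-1 *: (('X - a%:P) * ('X - b%:P) * ('X - c%:P) * Q ^+ 2) = 1 ->
  (1 - d%:P * 'X) * p ^+ 2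
  - (1 - a%:P * 'X) * (1 - b%:P * 'X) * (1 - c%:P * 'X) * q ^+ 2
  = K *: 'X^(2 * m.+1 + 1).
Proof.
move=> P Q p q; rewrite mulf_eq0 negb_or => /andP [K0 L0] PQ.
have pq : K^-1 *: ((1 - d%:P * 'X) * p ^+ 2) + L^-1 *: ((1 - a%:P * 'X)
    * (1 - b%:P * 'X) * (1 - c%:P * 'X) * q ^+ 2) = 'X^(2 * m.+1 + 1).
  apply: eq_poly_nonzero => t t0.
  have /(congr1 (fun r : {poly F} => r.[t^-1])) := PQ.
  rewrite !(hornerD, hornerN, hornerM, hornerZ, hornerC, hornerX, hornerXn,
            horner_exp).
  rewrite (prod_revE _ m.+1 x t t0) (prod_revE _ m y t t0) -/P -/Q.
  (* Each term is a product of [2 * m.+1 + 1] linear factors and takes one power of [t] for each. *)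
  move=> /(congr1 (fun r => r * t ^+ (2 * m.+1 + 1))); rewrite mul1r => <-.
  rewrite mulnC exprD exprM exprS.
  move: (t ^+ m) P.[_] Q.[_] => u v w.
  by field; rewrite K0 L0 t0.
(* At 0 the right side vanishes and all products equal 1, which forces [L^-1 = - K^-1]. *)
have := congr1 (fun r : {poly F} => r.[0]) pq.
rewrite !(hornerD, hornerN, hornerM, hornerZ, hornerC, hornerX, horner_exp).
rewrite !prod_rev0 !mulr0 !subr0 !mulr1 => /eqP.
rewrite addn1 exprS mul0r addrC addr_eq0 => /eqP KL.
rewrite -(addn1 (2 * m.+1)) -pq KL scaleNr scalerDr scalerN.
by rewrite !scalerA divff // !scale1r.
Qed.

(** * Pade approximation and the linear system for the denominator *)

(** The two hypotheses make a difference of squares divisible by ['X^N]; the factor with the plus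
    sign has value 2 at 0, hence is invertible modulo ['X^N]. *)
Lemma pade_rev (F : numFieldType) (N : nat) (a b c d K : F) (f p q : {poly F}) :
  f.[0] = 1 -> p.[0] = 1 -> q.[0] = 1 ->
  'X^N %| (1 - b%:P * 'X) * (1 - c%:P * 'X) * f ^+ 2
          - (1 - a%:P * 'X) * (1 - d%:P * 'X) ->
  (1 - d%:P * 'X) * p ^+ 2
  - (1 - a%:P * 'X) * (1 - b%:P * 'X) * (1 - c%:P * 'X) * q ^+ 2
  = K *: 'X^N ->
  'X^N %| f * p - (1 - a%:P * 'X) * q.
Proof.
move=> f0 p0 q0.
have h0 (e : F) : (1 - e%:P * 'X).[0] = 1 by rewrite !hornerE ?mulr0 ?subr0.
have := h0 a; have := h0 b; have := h0 c.
move: (1 - a%:P * 'X) (1 - b%:P * 'X) (1 - c%:P * 'X) (1 - d%:P * 'X).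
move=> la lb lc ld lc0 lb0 la0 hf pq.
rewrite -(@Gauss_dvdpr _ _ (lb * lc * (f * p + la * q))); last first.
  apply: coprimepXn; rewrite !(hornerM, hornerD) lb0 lc0 la0 f0 p0 q0 !mul1r.
  by rewrite (eqr_nat _ 2 0).
have -> : lb * lc * (f * p + la * q) * (f * p - la * q) =
  p ^+ 2 * (lb * lc * f ^+ 2 - la * ld)
  + la * (ld * p ^+ 2 - la * lb * lc * q ^+ 2).
  by ring.
by rewrite pq -mul_polyC; apply: dvdp_add; rewrite !dvdp_mull.
Qed.

Lemma Fmat_entry (F : fieldType) (s : nat -> F) (m : nat) (i j : 'I_m) :
  Fmat s m m i j = Fn s (m + i - j).
Proof.
rewrite mxE -PoszD subzn //.
by rewrite (leq_trans (ltnW (ltn_ord j))) ?leq_addr.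
Qed.

(** Cramer's rule: row [k] of the adjugate times the right-hand side is the expansion of
    [\det (Fmat_col s m k)] along column [k]. *)
Lemma det_Fmat_col (F : fieldType) (s : nat -> F) (m : nat) (u : 'cV[F]_m) :
  Fmat s m m *m u = \col_i - Fn s (m + i + 1) ->
  forall k, \det (Fmat_col s m k) = \det (Fmat s m m) * u k 0.
Proof.
move=> e k; have /matrixP/(_ k 0) := congr1 (mulmx (\adj (Fmat s m m))) e.
rewrite mulmxA mul_adj_mx mul_scalar_mx mxE => ->.
rewrite (expand_det_col _ k) mxE; apply: eq_bigr => i _.
rewrite !mxE eqxx mulrC; congr (_ * _); rewrite /cofactor; congr (_ * \det _).
by apply/matrixP => r t; rewrite !mxE eq_sym (negPf (neq_lift _ _)).
Qed.

(** A common divisor divides [K *: 'X^N], while [p] is coprime to ['X^N] because its constant term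
    is 1. *)
Lemma coprimep_pell_rev (F : fieldType) (N : nat) (K : F) (p e A B : {poly F}) :
  K != 0 -> p.[0] = 1 -> A * p - B * e = K *: 'X^N -> coprimep p e.
Proof.
move=> K0 p0 pe; rewrite /coprimep; set g := gcdp p e.
have gp : g %| p := dvdp_gcdl p e.
have gX : g %| 'X^N.
  rewrite -(dvdpZr _ _ K0) -pe dvdp_sub // dvdp_mull //; exact: dvdp_gcdr.
have cop : coprimep 'X^N p by apply: coprimepXn; rewrite p0 oner_neq0.
have : g %| gcdp 'X^N p by rewrite dvdp_gcd gX gp.
move: cop; rewrite /coprimep => /size_poly1P [k k0 ->].
by rewrite -[k%:P]mulr1 mul_polyC dvdpZr // dvdp1.
Qed.

(* A kernel vector V gives a second Pade pair (V, W) with p W = (1 - a X) q V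
   exactly, by degrees; coprimality makes p divide V and (1 - a X) q divide W,
   so both degrees drop and the left side of the identity for p and q cannot
   reach the degree of K X^(2m+3). *)
Lemma det_Fmat_neq0 (F : numFieldType) (m : nat) (s : nat -> F)
  (a b c d K : F) (p q : {poly F}) :
  let f := \poly_(i < (2 * m.+1).+1) Fn s i in
  K != 0 -> p.[0] = 1 -> q.[0] = 1 ->
  (size p <= m.+2)%N -> (size q <= m.+1)%N ->
  (1 - d%:P * 'X) * p ^+ 2
  - (1 - a%:P * 'X) * (1 - b%:P * 'X) * (1 - c%:P * 'X) * q ^+ 2
  = K *: 'X^(2 * m.+1 + 1) ->
  'X^(2 * m.+1 + 1) %| f * p - (1 - a%:P * 'X) * q ->
  \det (Fmat s m.+1 m.+1) != 0.
Proof.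
move=> f K0 p0 q0 sp sq pq fp; rewrite -det_tr; apply/det0P => -[v v0 Fv].
pose V := \poly_(j < m.+1) v 0 (inord j).
have sV : (size V <= m.+1)%N by exact: size_poly.
have V0 : V != 0.
  apply: contraNneq v0 => /polyP V0; apply/eqP/rowP => j.
  by have := V0 j; rewrite coef_poly ltn_ord inord_val coef0 mxE.
have fV i : (i < m.+1)%N -> (f * V)`_(m.+1 + i) = 0.
  move=> im; have /rowP/(_ (Ordinal im)) := Fv.
  rewrite !mxE => e; rewrite -[RHS]e.
  rewrite (@coefM_wide _ _ _ m.+1) ?sV ?ltnS ?leq_addr //.
    apply: eq_bigr => j _.
    rewrite mxE Fmat_entry coef_poly /V coef_poly ltn_ord inord_val mulrC /=.
    rewrite ltnS (leq_trans (leq_subr _ _)) // mul2n -addnn.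
    by rewrite leq_add2l ltnW.
  by rewrite leqW // leq_addr.
(* The coefficients of [f * V] in degrees m + 1 to 2m + 1 vanish, so truncation changes nothing
   modulo ['X^(2 * m.+1)]. *)
pose W := take_poly m.+1 (f * V).
have sW : (size W <= m.+1)%N by exact: size_take_poly.
have hW : 'X^(2 * m.+1) %| f * V - W.
  apply/dvdXnP => i im; rewrite coefB coef_take_poly; case: ltnP => h.
    by rewrite subrr.
  rewrite subr0 -(subnKC h) fV // -(ltn_add2l m.+1) subnKC //.
  by rewrite addnn -mul2n.
pose la : {poly F} := 1 - a%:P * 'X.
have pW : p * W = la * q * V.
  apply/eqP; rewrite -subr_eq0.
  have : 'X^(2 * m.+1) %| p * W - la * q * V.
    have -> : p * W - la * q * V = V * (f * p - la * q) - p * (f * V - W).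
      by ring.
    rewrite dvdp_sub ?dvdp_mull //.
    by apply: dvdp_trans fp; rewrite dvdp_exp2l // leq_addr.
  move=> D; apply/negPn/negP => nz.
  have := dvdp_leq nz D; rewrite size_polyXn ltnNge => /negP; apply.
  rewrite mul2n -addnn addnS (leq_trans (size_polyD _ _)) // geq_max size_polyN.
  apply/andP; split; first exact: size_mul_le.
  by apply: size_mul_le => //; rewrite (@size_mul_le _ _ _ 1 m) ?size_rev_factor.
have cop : coprimep p (la * q).
  apply: (@coprimep_pell_rev _ (2 * m.+1 + 1) K _ _ ((1 - d%:P * 'X) * p)
    ((1 - b%:P * 'X) * (1 - c%:P * 'X) * q)) => //.
  by rewrite -pq /la; ring.
have pV : p %| V by rewrite -(Gauss_dvdpr _ cop) -pW dvdp_mulr.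
have lqW : la * q %| W.
  have cop' : coprimep (la * q) p by rewrite coprimep_sym.
  by rewrite -(Gauss_dvdpr _ cop') pW dvdp_mulr.
have nlq : la * q != 0.
  apply/eqP => /(congr1 (horner^~ 0)).
  by rewrite hornerM q0 !hornerE ?mulr0 ?subr0 => /eqP; rewrite oner_eq0.
have W0 : W != 0.
  have : p * W != 0 by rewrite pW mulf_neq0.
  by rewrite mulf_eq0 negb_or => /andP [].
have sp' := leq_trans (dvdp_leq V0 pV) sV.
have sq' := leq_trans (dvdp_leq W0 lqW) sW.
have := congr1 (fun r : {poly F} => size r) pq.
rewrite size_scale // size_polyXn => e.
suff : ((2 * m.+1 + 1).+1 <= (2 * m.+1 + 1))%N by rewrite ltnn.
rewrite -[X in (X <= _)%N]e (leq_trans (size_polyD _ _)) // geq_max size_polyN.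
rewrite {1 2}addn1 (_ : 2 * m.+1 = 1 + (m + m) + 1)%N; last by clear; lia.
(* Keeping [la] with one [q] uses the lowered bound on [la * q]: the degree is at most 2m + 2,
   against 2m + 3 on the right. *)
have E : (1 - a%:P * 'X) * (1 - b%:P * 'X) * (1 - c%:P * 'X) * q ^+ 2 =
   (1 - b%:P * 'X) * (1 - c%:P * 'X) * (la * q * q) by rewrite /la; ring.
rewrite E; apply/andP; split.
  apply: (@leq_trans (1 + (m + m)).+1); last by clear; lia.
  by apply: size_mul_le; rewrite ?size_rev_factor // size_mul_le.
rewrite -addnA addnC -addnA.
apply: (@leq_trans ((1 + 1) + (m + m)).+1); last by clear; lia.
by apply: size_mul_le; apply: size_mul_le; rewrite // size_rev_factor.
Qed.

(** * The zeros of the determinantal polynomial *)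

Theorem theorem1 (C : numClosedFieldType) (m : nat) (hm : (1 <= m)%N)
  (a b c d : C) (T U : {poly C}) (x : 'I_m -> C) (y : 'I_m.-1 -> C)
  (hT : size T = (2 * m + 1).+1)
  (hU : (size U <= 2 * m)%N)
  (hPell : T ^+ 2 - Hpoly a b c d * U ^+ 2 = 1)
  (hDa : (a - d) * \prod_(j < m) (a - x j) ^+ 2 != 0)
  (hDd : (d - a) * (d - b) * (d - c) * \prod_(j < m.-1) (d - y j) ^+ 2 != 0)
  (hT1 : T = 1 - (2 / ((a - d) * \prod_(j < m) (a - x j) ^+ 2)) *:
                 (('X - d%:P) * \prod_(j < m) ('X - (x j)%:P) ^+ 2))
  (hT2 : T = -1 + (2 / ((d - a) * (d - b) * (d - c) *
                        \prod_(j < m.-1) (d - y j) ^+ 2)) *: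
                 (('X - a%:P) * ('X - b%:P) * ('X - c%:P) *
                  \prod_(j < m.-1) ('X - (y j)%:P) ^+ 2)) :
  let s := fun k : nat => (a ^+ k - b ^+ k - c ^+ k + d ^+ k) / 2 in
  \det (Fmat s m m) != 0 /\
  'X ^+ m * (\det (Fmat s m m))%:P
    + \sum_(i < m) (\det (Fmat_col s m i))%:P * 'X ^+ (m - 1 - i)
  = \det (Fmat s m m) *: \prod_(j < m) ('X - (x j)%:P).
Proof.
(* From here [m] is one less than in the statement: there are [m] values [y j], and [2 * m.+1 + 1]
   is the degree of [T]. *)
case: m => // m in hm x y hT hU hDa hDd hT1 hT2 *.
move=> s; move: hDa hDd hT1 hT2; rewrite !prodrXl /=.
move: (_ * _) (_ * _ * _ * _) => K L K0 L0 hT1 hT2.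
have KL : K * L != 0 by rewrite mulf_neq0.
have two0 : (2 : C) != 0 by rewrite pnatr_eq0.
have PQ : K^-1 *: (('X - d%:P) * (\prod_(i < m.+1) ('X - (x i)%:P)) ^+ 2)
    + L^-1 *: (('X - a%:P) * ('X - b%:P) * ('X - c%:P)
               * (\prod_(i < m) ('X - (y i)%:P)) ^+ 2) = 1.
  apply: (scalerI two0); rewrite scalerDr !scalerA.
  have := etrans (esym hT1) hT2; move: (2 / K *: _) (2 / L *: _) => u v e.
  have -> : u + v = u + 1 + (-1 + v) by ring.
  by rewrite -e scaler_nat; ring.
have := pell_rev _ _ _ _ _ _ _ _ _ _ KL PQ.
set p := \prod_(j < m.+1) (1 - _); set q := \prod_(j < m) (1 - _) => pq.
have p0 : p.[0] = 1 := prod_rev0 _ _ x.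
have q0 : q.[0] = 1 := prod_rev0 _ _ y.
have sp : (size p <= m.+2)%N := size_prod_rev _ _ x.
have sq : (size q <= m.+1)%N := size_prod_rev _ _ y.
pose f := \poly_(i < (2 * m.+1).+1) Fn s i.
have fE k : (k < 2 * m.+1 + 1)%N -> f`_k = Fn s k.
  by rewrite coef_poly addn1 => ->.
have f0 : f.[0] = 1 by rewrite horner_coef0 coef_poly.
have fp : 'X^(2 * m.+1 + 1) %| f * p - (1 - a%:P * 'X) * q.
  apply: (@pade_rev _ _ a b c d K) => //; rewrite addn1; exact: Fn_sq.
have det0 := det_Fmat_neq0 _ _ _ _ _ _ _ _ _ _ K0 p0 q0 sp sq pq fp.
split=> //.
(* Degree [m.+1 + i + 1] exceeds that of [(1 - a%:P * 'X) * q], so this coefficient of [f * p]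
   vanishes. The constant term 1 of [p] supplies the right-hand side, hence the shift in the
   unknowns. *)
have Fu : Fmat s m.+1 m.+1 *m (\col_j p`_j.+1) = \col_i - Fn s (m.+1 + i + 1).
  apply/matrixP => i z; rewrite !mxE.
  have ki : (m.+1 + i + 1 < 2 * m.+1 + 1)%N.
    by rewrite ltn_add2r mul2n -addnn ltn_add2l.
  move/dvdXnP: fp => /(_ _ ki).
  rewrite coefB [_`_(m.+1 + i + 1) in X in _ - X]nth_default; last first.
    rewrite (leq_trans (@size_mul_le _ _ _ 1 m (size_rev_factor _ _) sq)) //.
    by rewrite addn1 addSn !ltnS leq_addr.
  rewrite subr0 (@coefM_wide _ _ _ m.+2) ?sp; last first.
    by rewrite addn1 addSn !ltnS leqW ?leq_addr.
  rewrite big_ord_recl -[p`_ord0]horner_coef0 p0 mulr1 subn0 fE //.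
  move/eqP; rewrite addrC addr_eq0 => /eqP <-; apply: eq_bigr => j _.
  rewrite Fmat_entry mxE fE lift0; first by rewrite addn1 subSS.
  exact: leq_ltn_trans (leq_subr _ _) ki.
(* The constant term of [p] gives the leading term of the product; Cramer's rule gives the
   others. *)
rewrite prod_XsubC_rev -/p [X in _ = _ *: X]big_ord_recl scalerDr.
rewrite -[p`_ord0]horner_coef0 p0 scale1r subn0 mulrC mul_polyC; congr (_ + _).
rewrite scaler_sumr; apply: eq_bigr => i _.
by rewrite (det_Fmat_col _ _ _ _ Fu) mxE mul_polyC scalerA lift0 !subSS subn0.
Qed.
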